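(* Let $\langle\mathcal{A}\,\|\,\mathcal{R}\rangle$ be a group presentation with finite alphabet $\mathcal{A}$ and let $f_0,f_1,f_2$ be its Dehn $j$-functions. (a) For every such presentation, $f_0(x)\le 2f_1(x)$ and $f_2(x)\le 2f_1(x)$. In particular, $f_0(x)\preccurlyeq f_1(x)$ and $f_2(x)\preccurlyeq f_1(x)$. (b) Let every element of $\mathcal{R}$ be a word of length $>1$. Then the Dehn functions $f_0(x)$ and $f_1(x)$ of $\langle\mathcal{A}\,\|\,\mathcal{R}\rangle$ are equivalent, i.e. $f_0\simeq f_1$.
   Context: Presentations. $\mathcal{A}=\{a_1,\dots,a_m\}$ is a finite alphabet, $\mathcal{A}^{\pm1}=\mathcal{A}\cup\mathcal{A}^{-1}$, $F(\mathcal{A})$ is the free group over $\mathcal{A}$, and $|W|$ is the length of a word $W\in F(\mathcal{A})$ over the alphabet $\mathcal{A}^{\pm1}$. The relator set $\mathcal{R}$ (possibly infinite) consists of nonempty cyclically reduced words over $\mathcal{A}^{\pm1}$; $\langle\langle\mathcal{R}\rangle\rangle$ is its normal closure in $F(\mathcal{A})$, and $\langle\mathcal{A}\,\|\,\mathcal{R}\rangle$ presents the group $F(\mathcal{A})/\langle\langle\mathcal{R}\rangle\rangle$. Van Kampen diagrams. $K(\mathcal{A},\mathcal{R})$ is the standard 2-complex of the presentation: it has a single 0-cell, its oriented 1-cells are in bijection with the letters of $\mathcal{A}^{\pm1}$, and its 2-cells are in bijection with the words of $\mathcal{R}$, which determine their attaching maps. A van Kampen diagram over $\langle\mathcal{A}\,\|\,\mathcal{R}\rangle$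 is a planar, finite, connected and simply connected 2-complex $\Delta$ equipped with a continuous cellular map $\mu:\Delta\to K(\mathcal{A},\mathcal{R})$ whose restriction to every cell of $\Delta$ is a homeomorphism. An edge is the closure of a 1-cell. If $e$ is an oriented edge and $\mu(e)$ corresponds to the letter $a\in\mathcal{A}^{\pm1}$, then $a$ is the label $\varphi(e)$ of $e$; $\varphi(e^{-1})=\varphi(e)^{-1}$, where $e^{-1}$ is $e$ with opposite orientation. The label of a path $p=e_1\cdots e_k$ is $\varphi(p)=\varphi(e_1)\cdots\varphi(e_k)$. $\partial\Delta$ is the boundary path of $\Delta$, $\varphi(\partial\Delta)\equiv W$ means literal equality of cyclic words, and $|\Delta(j)|$ is the number of $j$-cells of $\Delta$. By van Kampen's lemma, a word $W$ belongs to $\langle\langle\mathcal{R}\rangle\rangle$ if and only if there is a van Kampen diagram $\Delta$ over the presentation with $\varphi(\partial\Delta)\equiv W$. Dehn $j$-functions. For $W\in\langle\langle\mathcal{R}\rangle\rangle$ and $j\in\{0,1,2\}$ let $L_j(W)=\min\{|\Delta(j)| : \varphi(\partial\Delta)\equiv W\}$, the minimum over van Kampen diagrams $\Delta$ over the presentation. For an integer $x\ge1$, the Dehn $j$-function of the presentation is $f_j(x)=\max\{L_j(W) : W\in\langle\langle\mathcal{R}\rangle\rangle \text{ and } |W|\le x\}$. Comparison of functions. For functions $f,g:\mathbb{N}\to\mathbb{N}\cup\{0\}$, where $\mathbb{N}=\{1,2,\dots\}$, write $f\preccurlyeq g$ if there is an integer $C>0$ such that $f(x)\le C\,g(Cx)+Cx$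 for every $x\in\mathbb{N}$. The functions are (linearly) equivalent, $f\simeq g$, if $f\preccurlyeq g$ and $g\preccurlyeq f$.
   Formalization: The maximum defining f_j is taken over nonempty words W (and is 0 if there are none): with the empty word, L_0=1 and L_1=0, so f_0(x)≤2f_1(x) fails at x=1 e.g. for empty R; f_1, f_2 and the relations ≼, ≃ are unaffected. *)

(* Defs.v *)
From mathcomp Require Import all_boot.
From mathcomp Require Import boolp.

Set Implicit Arguments.
Unset Strict Implicit.
Unset Printing Implicit Defensive.

Section Words.
Variable A : finType.

(* (a, false) is the letter a, and (a, true) is its inverse. *)
Definition letter := (A * bool)%type.
Definition word := seq letter.

Definition linv (x : letter) : letter := (x.1, ~~ x.2).
Definition winv (w : word) : word := rev (map linv w).

Definition cyclically_reduced (w : word) : bool :=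
  cycle (fun x y => y != linv x) w.

Definition cyclic_eq (u v : word) : Prop := exists k, u = rot k v.

(* Free reduction: two words are equal in F(A) iff they have the same
   reduced form. *)
Definition free_cons (x : letter) (w : word) : word :=
  if w is y :: w' then (if y == linv x then w' else x :: w) else [:: x].
Definition free_reduce (w : word) : word := foldr free_cons [::] w.

(* Words, not necessarily reduced, whose value in F(A) lies in the smallest
   normal subgroup containing R. *)
Inductive normal_closure (R : word -> Prop) : word -> Prop :=
| nc_rel r : R r -> normal_closure R r
| nc_one : normal_closure R [::]
| nc_mul u v :
    normal_closure R u -> normal_closure R v -> normal_closure R (u ++ v)
| nc_inv u : normal_closure R u -> normal_closure R (winv u)
| nc_conj u v : normal_closure R v -> normal_closure R (winv u ++ v ++ u)
| nc_free u v :
    free_reduce u = free_reduce v -> normal_closure R u -> normal_closure R v.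

(* A finite connected and simply connected 2-complex in the plane that has at
   least one edge is a cell structure on the sphere with one face, the outer
   one, removed.  Such a cell structure is encoded by its oriented edges
   (darts): dopp reverses a dart, and dnext d follows d on the contour of the
   face lying to the left of d.  Thus dnext d starts where d ends, the faces
   are the orbits of dnext, and d |-> dnext (dopp d) turns around the origin
   of d, so that its orbits are the vertices.  For a connected map, Euler's
   formula says that the surface is a sphere.  The outer face is the one whose
   contour contains dbase. *)
Structure disc_map := DiscMap {
  dart : finType;
  dopp : dart -> dart;
  dnext : dart -> dart;
  dlab : dart -> letter;
  dbase : dart;
  doppK : involutive dopp;
  dopp_neq : forall d, dopp d != d;
  dnext_inj : injective dnext;
  dlab_opp : forall d, dlab (dopp d) = linv (dlab d);
  dconnected : forall d d' : dart,
    connect [rel x y | (y == dopp x) || (y == dnext x)] d d';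
  deuler : fcard (fun d => dnext (dopp d)) dart + fcard dnext dart
           = fcard dopp dart + 2
}.

Definition face_label (M : disc_map) (d : dart M) : word :=
  [seq dlab d' | d' <- orbit (@dnext M) d].

(* A complex without edges is a single vertex. *)
Inductive diagram := Point | Disc of disc_map.

(* The contour of the outer face keeps the complex on its right, so this is
   the clockwise boundary path.  Reflecting a diagram shows that the choice of
   direction does not affect the filling functions below. *)
Definition boundary_label (D : diagram) : word :=
  if D is Disc M then face_label (dbase M) else [::].

(* Every 2-cell, that is, every face other than the outer one, is mapped to a
   2-cell of the presentation complex: its contour reads a relator or the
   inverse of one, from some starting point. *)
Definition diagram_over (R : word -> Prop) (D : diagram) : Prop :=
  if D is Disc M then
    forall d : dart M, ~~ fconnect (@dnext M) (dbase M) d ->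
      exists r, R r /\
        (cyclic_eq (face_label d) r \/ cyclic_eq (face_label d) (winv r))
  else True.

Definition ncells (j : nat) (D : diagram) : nat :=
  match D, j with
  | Point, 0 => 1
  | Disc M, 0 => fcard (fun d => dnext (dopp d)) (dart M)
  | Disc M, 1 => fcard (@dopp M) (dart M)
  | Disc M, 2 => (fcard (@dnext M) (dart M)).-1
  | _, _ => 0
  end.

Definition min_nat (P : nat -> Prop) : nat :=
  if pselect (exists n, `[< P n >]) is left exP then ex_minn exP else 0.

Definition filling (R : word -> Prop) (j : nat) (W : word) : nat :=
  min_nat (fun n => exists D : diagram,
    [/\ diagram_over R D, cyclic_eq (boundary_label D) W & ncells j D = n]).

(* The maximum is over the nonempty words W, and it is 0 if there are none.
   The empty word is left out because it is bounded by the one-vertex diagram,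
   with one 0-cell and no 1-cells: were it admitted, f_0 would be 1 and f_1
   would be 0 at every x for which no nonempty W qualifies, and f_0 <= 2 f_1
   would fail there.  Nothing else depends on this choice: the empty word
   contributes 0 to f_1 and f_2, and 1 to f_0. *)
Definition dehn (R : word -> Prop) (j : nat) (x : nat) : nat :=
  \max_(1 <= n < x.+1)
    \max_(W : n.-tuple letter | `[< normal_closure R W >]) filling R j W.

End Words.

(* Functions on the positive integers; the values at 0 are irrelevant. *)
Definition dominated (f g : nat -> nat) : Prop :=
  exists C, 0 < C /\ forall x, 0 < x -> f x <= C * g (C * x) + C * x.

Definition lin_equiv (f g : nat -> nat) : Prop :=
  dominated f g /\ dominated g f.

(* Main.v *)
Require Import Defs.
From mathcomp Require Import all_boot.
From mathcomp Require Import boolp zify.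

Set Implicit Arguments.
Unset Strict Implicit.
Unset Printing Implicit Defensive.

(* (a) holds diagram by diagram, since the vertices and the faces are orbits of
   permutations of the set of darts, which has 2E elements.
   For (b), consider strips of consecutive bigonal 2-cells.  If two edges of a
   strip carry the same label, then the part of the strip between them can be
   cut out and its two sides glued together; this preserves the boundary label
   and the number of vertices.  Hence every W bounds, without additional
   vertices, a diagram whose strips are shorter than the number N of letters.
   Merging every strip into one edge leaves at least E / N edges and only
   2-cells of degree at least 3, because there are none of degree 1, so Euler's
   formula gives E <= 3 N V. *)

(** * Orbits and connectivity on finite types *)

Lemma connect_ind (T : finType) (e : rel T) (P : T -> Prop) :
  (forall x y, e x y -> P x -> P y) -> forall x y, connect e x y -> P x -> P y.
Proof.
move=> eP x y /connectP[p]; elim: p x => [|z p IHp] x /=; first by move=> _ ->.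
by case/andP=> exz pth ly Px; apply: (IHp z) => //; apply: eP Px.
Qed.

(** Grouping [a] by orbit roots splits it into whole orbits, since [a] is closed; each has at least
    [n] elements. *)
Lemma leq_fcard_order (T : finType) (f : T -> T) (a : {pred T}) n :
    injective f -> fclosed f a -> {in a, forall x, n <= order f x} ->
  fcard f a * n <= #|a|.
Proof.
move=> injf cl_a a_n; have symf := fconnect_sym injf.
have root_a x : (froot f x \in a) = (x \in a).
  exact/esym/(closed_connect cl_a)/connect_root.
rewrite -sum1_card (partition_big (froot f) [predI froots f & a]) => [|x a_x].
  rewrite -sum_nat_const; apply: leq_sum => x /andP[/eqP x_root a_x].
  apply: leq_trans (a_n x a_x) _; rewrite sum1_card; apply: subset_leq_card.
  apply/subsetP=> y xy; apply/andP; split.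
    by rewrite -(closed_connect cl_a xy).
  by rewrite -x_root eq_sym (root_connect symf).
by rewrite !inE roots_root //= root_a.
Qed.

Lemma leq_fcard (T : finType) (f : T -> T) (a : {pred T}) : fcard f a <= #|a|.
Proof. by apply: subset_leq_card; apply/subsetP=> x /andP[]. Qed.

Lemma order_eq2 (T : finType) (f : T -> T) x :
  order f x = 2 -> f x != x.
Proof.
move=> ox2; apply/eqP=> fx.
by have := orbit_uniq f x; rewrite /orbit ox2 /= fx inE eqxx.
Qed.

Lemma fcard_involution (T : finType) (f : T -> T) :
  involutive f -> (forall x, f x != x) -> fcard f T * 2 = #|T|.
Proof.
move=> fK fN; apply: fcard_order_set => //; first exact: can_inj fK.
apply/subsetP=> x _; rewrite !inE.
have uf : uniq [:: x; f x] by rewrite /= inE eq_sym fN.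
by rewrite (order_cycle (p := [:: x; f x])) //= ?fK ?eqxx ?inE ?eqxx.
Qed.

(** * Orbits of a map restricted to a subtype *)

Section SubOrbits.

Variables (T : finType) (P : pred T) (f : T -> T) (f' : {x | P x} -> {x | P x}).
Hypothesis f'E : forall x, val (f' x) = f (val x).

Lemma val_iter n x : val (iter n f' x) = iter n f (val x).
Proof. by elim: n => // n IHn; rewrite !iterS f'E IHn. Qed.

Lemma fconnect_val x y : fconnect f' x y = fconnect f (val x) (val y).
Proof.
apply/idP/idP=> [/iter_findex <-|/iter_findex].
  by rewrite val_iter fconnect_iter.
by rewrite -val_iter => /val_inj <-; rewrite fconnect_iter.
Qed.

Lemma map_val_orbit x : map val (orbit f' x) = orbit f (val x).
Proof.
have map_traject n y : map val (traject f' y n) = traject f (val y) n.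
  by elim: n y => //= n IHn y; rewrite IHn f'E.
rewrite /orbit map_traject; congr traject.
(* Both trajectories start at [val x], so only their lengths need comparison; the two orbits are
   duplicate-free with the same elements. *)
rewrite -(size_orbit f') -(size_map val) -(size_orbit f (val x)).
apply/perm_size/uniq_perm; rewrite ?orbit_uniq ?(map_inj_uniq val_inj) ?orbit_uniq//.
move=> y; rewrite -fconnect_orbit; apply/mapP/idP=> [[z]|].
  by rewrite -fconnect_orbit fconnect_val => xz ->.
move=> /iter_findex <-; exists (iter (findex f (val x) y) f' x).
  by rewrite -fconnect_orbit fconnect_iter.
by rewrite val_iter.
Qed.

Lemma fcard_val : injective f -> fclosed f P -> fcard f' {: {x | P x}} = fcard f P.
Proof.
move=> injf cl_P.
have injf' : injective f'.
  by move=> x y /(congr1 val); rewrite !f'E => /injf /val_inj.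
rewrite (adjunction_n_comp val (fconnect_sym injf) (fconnect_sym injf') cl_P).
  by apply: eq_n_comp_r => x; rewrite !inE; apply/esym/(valP x).
split=> [x Px|x' y' _]; last exact: fconnect_val.
by exists (exist _ x Px).
Qed.

End SubOrbits.

(** * Strips of bigonal 2-cells *)

Section Strips.

Variables (A : finType) (M : disc_map A).
Implicit Types x y d : dart M.

Definition inner x := ~~ fconnect (@dnext _ M) (dbase M) x.
Definition bigon x := inner x && (order (@dnext _ M) x == 2).
(** On a bigon this is the opposite side, with the same origin and end as [x] but with the next face
    on its left; iterating it traverses a strip. *)
Definition across x := dopp (dnext x).
Definition strip k d := forall i, i < k -> bigon (iter i across d).

Lemma dopp_inj : injective (@dopp _ M).
Proof. exact: can_inj (@doppK _ M). Qed.

Lemma fconnect_dnext x y :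
  fconnect (@dnext _ M) x (dnext y) = fconnect (@dnext _ M) x y.
Proof. by rewrite -same_fconnect1_r //; apply: dnext_inj. Qed.

Lemma inner_dnext x : inner (dnext x) = inner x.
Proof. by rewrite /inner fconnect_dnext. Qed.

Lemma bigon_dnext x : bigon (dnext x) = bigon x.
Proof.
rewrite /bigon inner_dnext order_id_cycle //.
exact: cycle_orbit (@dnext_inj _ M) x.
Qed.

Lemma bigonK x : bigon x -> dnext (dnext x) = x.
Proof.
by case/andP=> _ /eqP ox2; have := iter_order (@dnext_inj _ M) x; rewrite ox2.
Qed.

Lemma bigon_neq x : bigon x -> dnext x != x.
Proof. by case/andP=> _ /eqP/order_eq2. Qed.

Lemma across_inj : injective across.
Proof. by move=> x y /dopp_inj /dnext_inj. Qed.

(* Otherwise the strip would be a Moebius band; the argument folds it from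
   both ends towards its core. *)
Lemma strip_neq_opp k d : strip k d -> iter k across d != dopp d.
Proof.
elim/ltn_ind: k d => -[|[|k]] IHk d sd; first by rewrite eq_sym dopp_neq.
  by rewrite /= (inj_eq dopp_inj) bigon_neq //; apply: (sd 0).
have b0 : bigon d by apply: (sd 0).
(* Cancelling [dopp] and [dnext] drops the bigons at both ends and leaves the claim for the [k]
   bigons from [across d] on. *)
rewrite iterS iterSr {1}/across (inj_eq dopp_inj) -{2}(bigonK b0).
rewrite (inj_eq (@dnext_inj _ M)) -[dnext d]doppK; apply: IHk => // i lt_ik.
by rewrite -iterSr; apply: sd; lia.
Qed.

(* A cyclic strip would be closed under both permutations of the darts, hence
   would contain the outer face. *)
Lemma strip_acyclic k d : 0 < k -> strip k d -> iter k across d != d.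
Proof.
move=> k_gt0 sd; apply/eqP=> dK.
have iter_mod i : iter i across d = iter (i %% k) across d.
  rewrite {1}(divn_eq i k) addnC iterD; congr (iter _ _ _).
  by elim: (_ %/ _) => //= q IHq; rewrite mulSn iterD IHq.
have b i : bigon (iter i across d).
  by rewrite iter_mod; apply: sd; rewrite ltn_mod.
pose Q x := exists i, x = iter i across d \/ x = dnext (iter i across d).
have Qstep x y : (y == dopp x) || (y == dnext x) -> Q x -> Q y.
  case/orP=> /eqP-> [i [] ->].
  (* One step back along the cycle is [k.-1] steps forward. *)
  - exists (i + k.-1); right; apply: dopp_inj; rewrite doppK.
    by rewrite -[RHS]/(iter (i + k.-1).+1 across d) -addnS prednK // iterD dK.
  - by exists i.+1; left.
  - by exists i; right.
  - by exists i; left; rewrite bigonK.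
have [|i [] base_i] := connect_ind Qstep (dconnected d (dbase M)).
- by exists 0; left.
- by have /andP[] := b i; rewrite /inner -base_i connect0.
by have /andP[] := b i; rewrite -inner_dnext /inner -base_i connect0.
Qed.

End Strips.

(* Deleting the strip of bigons d, ..., s^(k-1) d, where s = across, and gluing
   its two sides dopp d and e = s^k d together. *)
Section RemoveStrip.

Variables (A : finType) (M : disc_map A) (k : nat) (d : dart M).
Hypotheses (k_gt0 : 0 < k) (strip_d : strip k d).
Let e := iter k (@across _ M) d.
Hypothesis lab_e : dlab e = dlab d.

(** [S1] and [S2] collect the darts of the strip parallel and antiparallel to [d]; [dnext] exchanges
    the two darts of a bigon. *)
Let S1 x := [exists i : 'I_k, x == iter i (@across _ M) d].
Let S2 x := S1 (dnext x).
Let S x := S1 x || S2 x.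

Let S1P x : reflect (exists2 i, i < k & x = iter i (@across _ M) d) (S1 x).
Proof.
apply: (iffP existsP) => [[i /eqP->]|[i lt_ik ->]]; first by exists i.
by exists (Ordinal lt_ik) => /=.
Qed.

Let S1_bigon x : S1 x -> bigon x.
Proof. by case/S1P=> i lt_ik ->; apply: strip_d. Qed.

Let S1_next x : S1 x -> S2 (dnext x).
Proof. by move=> S1x; rewrite /S2 /= bigonK // S1_bigon. Qed.

Let S2_bigon x : S2 x -> bigon x.
Proof. by rewrite -bigon_dnext => /S1_bigon. Qed.

Let S1_d : S1 d. Proof. by apply/S1P; exists 0. Qed.

(** Reversing a dart of [S1] passes to the preceding bigon, and reversing one of [S2] to the
    following bigon; the only exits are at [d] and at [e]. *)
Let S1_opp x : S1 x -> x = d \/ S2 (dopp x).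
Proof.
case/S1P=> -[|i] lt_ik ->; [by left | right].
by rewrite iterS doppK S1_next //; apply/S1P; exists i => //; apply: ltnW.
Qed.

Let S2_opp x : S2 x -> dopp x = e \/ S1 (dopp x).
Proof.
move=> S2x; have bx := S2_bigon S2x; case/S1P: S2x => i lt_ik xE.
have -> : dopp x = iter i.+1 (@across _ M) d.
  by rewrite iterS -xE /across bigonK.
case: (ltngtP i.+1 k) => [lt_i1k | | ->]; last by left.
  by right; apply/S1P; exists i.+1.
by rewrite ltnNge lt_ik.
Qed.

Let strip_sub i j : i <= k -> j <= i -> strip (i - j) (iter j (@across _ M) d).
Proof. by move=> ik ji m lt_m; rewrite -iterD; apply: strip_d; lia. Qed.

Let iter_neq_opp i j : i <= k -> j <= k ->
  iter i (@across _ M) d != dopp (iter j (@across _ M) d).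
Proof.
have main a b : a <= k -> b <= a ->
    iter a (@across _ M) d != dopp (iter b (@across _ M) d).
  move=> ak ba; rewrite -{1}(subnK ba) iterD.
  exact: strip_neq_opp (strip_sub ak ba).
move=> ik jk; case/orP: (leq_total j i) => ij; first exact: main.
by rewrite -(inj_eq (@dopp_inj _ M)) doppK eq_sym main.
Qed.

Let iter_neq i j : i <= k -> j < i -> iter i (@across _ M) d != iter j (@across _ M) d.
Proof.
move=> ik ji; rewrite -{1}(subnK (ltnW ji)) iterD.
by apply: strip_acyclic; [lia | apply: strip_sub => //; apply: ltnW].
Qed.

(** A common dart would be both an iterate and the reverse of an iterate, as in a Moebius band. *)
Let S1N2 x : S1 x -> ~~ S2 x.
Proof.
move=> S1x; apply/negP=> S2x; have bx := S2_bigon S2x.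
case/S1P: S1x => i lt_ik xi; case/S1P: S2x => j lt_jk xj.
have : iter j.+1 (@across _ M) d = dopp x by rewrite iterS -xj /across bigonK.
by apply/eqP; rewrite xi iter_neq_opp // ltnW.
Qed.

(** The outer sides [e] and [dopp d] of the strip survive. For [e], membership in [S1] would close
    the strip up cyclically and membership in [S2] would make it a Moebius band; for [dopp d] the
    two reasons are interchanged. *)
Let S_e : ~~ S e.
Proof.
rewrite /S /= negb_or; apply/andP; split.
  by apply/S1P=> -[i lt_ik ek]; have := iter_neq (leqnn k) lt_ik; rewrite -ek eqxx.
apply/negP=> S2e; have be := S2_bigon S2e; case/S1P: S2e => j lt_jk ej.
have : iter j.+1 (@across _ M) d = dopp e by rewrite iterS -ej /across bigonK.
by apply/eqP; rewrite iter_neq_opp.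
Qed.

Let S_d' : ~~ S (dopp d).
Proof.
rewrite /S /= negb_or; apply/andP; split.
  by apply/S1P=> -[i lt_ik /eqP]; rewrite eq_sym; apply/negP/(@iter_neq_opp i 0) => //; lia.
apply/negP=> S2d; have bd := S2_bigon S2d; case/S1P: S2d => j lt_jk dj.
have : iter j.+1 (@across _ M) d = d by rewrite iterS -dj /across bigonK ?doppK.
by apply/eqP; apply: (@iter_neq j.+1 0).
Qed.

Let S2_e' : S2 (dopp e).
Proof.
rewrite /e -(prednK k_gt0) iterS doppK S1_next //.
by apply/S1P; exists k.-1; rewrite ?prednK.
Qed.

Let e_neq : e != dopp d.
Proof. exact: (@iter_neq_opp k 0). Qed.

Let Sopp1 x : ~~ S x -> S1 (dopp x) -> x = dopp d.
Proof.
move=> Sx /S1_opp[<- | ]; first by rewrite doppK.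
by rewrite doppK => S2x; rewrite /S /= S2x orbT in Sx.
Qed.

Let Sopp2 x : ~~ S x -> S2 (dopp x) -> x = e.
Proof.
move=> Sx /S2_opp[<- | ]; first by rewrite doppK.
by rewrite doppK => S1x; rewrite /S /= S1x in Sx.
Qed.

Let S_next x : S (dnext x) = S x.
Proof.
apply/idP/idP; rewrite /S /=; case/orP.
- by move=> S2x; apply/orP; right.
- move=> S2x; have /dnext_inj/dnext_inj xK := bigonK (S1_bigon S2x).
  by rewrite -[x in S1 x]xK [S1 _]S2x.
- by move=> S1x; rewrite S1_next ?orbT.
by move=> S2x; rewrite [S1 _]S2x.
Qed.

(* rho moves every dart of the strip to the parallel side of the glued edge. *)
Let rho x := if S1 x then e else if S2 x then dopp d else x.

Let rho1 x : S1 x -> rho x = e. Proof. by rewrite /rho => ->. Qed.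
Let rho2 x : S2 x -> rho x = dopp d.
Proof. by rewrite /rho => S2x; rewrite S2x (contraTF (S1N2 (x := x))) // negbK. Qed.
Let rhoN x : ~~ S x -> rho x = x.
Proof. by rewrite /rho /S /= negb_or => /andP[/negPf-> /negPf->]. Qed.

Let rhoP x : ~~ S (rho x).
Proof.
rewrite /rho; case S1x: (S1 x) => //; case S2x: (S2 x) => //.
by rewrite /S S1x S2x.
Qed.

Let rho_opp x : rho (dopp (rho x)) = rho (dopp x).
Proof.
case S1x: (S1 x).
  rewrite (rho1 S1x) rho2 //.
  by case: (S1_opp S1x) => [->|/rho2->//]; rewrite rhoN.
case S2x: (S2 x).
  rewrite (rho2 S2x) doppK rho1 //.
  by case: (S2_opp S2x) => [->|/rho1->//]; rewrite rhoN.
by rewrite (rhoN (x := x)) // /S /= S1x S2x.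
Qed.

Let dart' : finType := {x : dart M | ~~ S x}.
Let rhoT x : dart' := exist _ (rho x) (rhoP x).
(** The gluing: [dopp'] exchanges [e] and [dopp d] and agrees with [dopp] elsewhere. In [dnext'] the
    map [rho] moves nothing, because whole faces are deleted. *)
Let dopp' (x : dart') : dart' := rhoT (dopp (val x)).
Let dnext' (x : dart') : dart' := rhoT (dnext (val x)).

Let rhoTK (x : dart') : rhoT (val x) = x.
Proof. by apply: val_inj; rewrite /= rhoN // (valP x). Qed.

Let dnext'E x : val (dnext' x) = dnext (val x).
Proof. by rewrite /= rhoN // S_next (valP x). Qed.

Let dopp'K : involutive dopp'.
Proof. by move=> x; apply: val_inj; rewrite /= rho_opp doppK rhoN // (valP x). Qed.

Let dopp'_neq x : dopp' x != x.
Proof.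
rewrite -val_eqE /=; have Sx := valP x; rewrite /rho.
case S1x: (S1 _); first by rewrite (Sopp1 Sx S1x).
by case S2x: (S2 _); rewrite ?dopp_neq // (Sopp2 Sx S2x) eq_sym.
Qed.

Let dnext'_inj : injective dnext'.
Proof. by move=> x y /(congr1 val); rewrite !dnext'E => /dnext_inj /val_inj. Qed.

(** Since [e] and [d] carry the same label, the new edge is labelled consistently. *)
Let dlab'_opp x : dlab (val (dopp' x)) = linv (dlab (val x)).
Proof.
have Sx := valP x; rewrite /= /rho.
have [lK lE] : (dlab (dopp d) = linv (dlab d)) /\ linv (linv (dlab d)) = dlab d.
  by rewrite dlab_opp /linv /= negbK; case: (dlab d).
case S1x: (S1 _); first by rewrite (Sopp1 Sx S1x) lab_e lK lE.
by case S2x: (S2 _); rewrite ?dlab_opp // (Sopp2 Sx S2x) lab_e.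
Qed.

Let dopp'_rho x : dopp' (rhoT x) = rhoT (dopp x).
Proof. by apply: val_inj; rewrite /= rho_opp. Qed.

(** [rhoT] carries paths to paths: a [dopp] step becomes a [dopp'] step, and a [dnext] step becomes
    a [dopp'] step inside the strip and a [dnext'] step outside. *)
Let dconnected' (x y : dart') :
  connect [rel x y | (y == dopp' x) || (y == dnext' x)] x y.
Proof.
set r := (X in connect X); rewrite -(rhoTK y).
apply: (connect_ind (P := fun z => connect r x (rhoT z)) _
          (dconnected (val x) (val y))).
  move=> a b /orP[]/eqP-> xa; apply: connect_trans xa _.
    by rewrite -dopp'_rho; apply: connect1; rewrite /r /= eqxx.
  case S1a: (S1 a).
    have -> : rhoT (dnext a) = dopp' (rhoT a).
      by apply: val_inj; rewrite /= (rho1 S1a) !rho2 ?S1_next.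
    by apply: connect1; rewrite /r /= eqxx.
  case S2a: (S2 a).
    have -> : rhoT (dnext a) = dopp' (rhoT a).
      by apply: val_inj; rewrite /= (rho2 S2a) doppK !rho1.
    by apply: connect1; rewrite /r /= eqxx.
  have -> : rhoT (dnext a) = dnext' (rhoT a).
    by apply: val_inj; rewrite /= (rhoN (x := a)) // /S /= S1a S2a.
  by apply: connect1; rewrite /r /= eqxx orbT.
by rewrite rhoTK.
Qed.

Let nu (x : dart M) := dnext (dopp x).
Let nu' x := dnext' (dopp' x).

Let nu_inj : injective nu.
Proof. by move=> x y /dnext_inj /dopp_inj. Qed.

Let nu'_inj : injective nu'.
Proof. by move=> x y /dnext'_inj /(can_inj dopp'K). Qed.

Let nu_across x : bigon x -> nu (across x) = x.
Proof. by move=> bx; rewrite /nu /across doppK bigonK. Qed.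

(** All parallel darts of the strip have the same origin, so [rho] stays within a vertex. *)
Let connect_rho x : fconnect nu x (rho x).
Proof.
have symn := fconnect_sym nu_inj.
have conn1 i : i <= k -> fconnect nu (iter i (@across _ M) d) d.
  elim: i => [|i IHi] lt_ik; first exact: connect0.
  apply: connect_trans (IHi (ltnW lt_ik)).
  rewrite -(nu_across (strip_d lt_ik)); exact: fconnect1.
have conn2 i : i <= k ->
    fconnect nu (dopp d) (dopp (iter i (@across _ M) d)).
  elim: i => [|i IHi] lt_ik; first exact: connect0.
  apply: connect_trans (IHi (ltnW lt_ik)) _.
  rewrite [iter i.+1 _ _]iterS /across doppK.
  have -> : dnext (iter i (@across _ M) d) = nu (dopp (iter i (@across _ M) d)).
    by rewrite /nu doppK.
  exact: fconnect1.
case S1x: (S1 x).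
  rewrite (rho1 S1x); case/S1P: S1x => i lt_ik ->.
  apply: connect_trans (conn1 i (ltnW lt_ik)) _.
  by rewrite symn; apply: conn1.
case S2x: (S2 x); last by rewrite rhoN ?connect0 // /S /= S1x S2x.
rewrite (rho2 S2x) symn; have bx := S2_bigon S2x; case/S1P: S2x => i lt_ik xi.
have <- : dopp (iter i.+1 (@across _ M) d) = x.
  by rewrite iterS doppK -xi bigonK.
exact: conn2.
Qed.

(** If [dopp x] lies in the strip, then turning from [x] to [nu x] crosses a bigon and is collapsed
    by [rhoT]; otherwise it is a turn of the new map. *)
Let nu'_rho x : connect (frel nu') (rhoT x) (rhoT (nu x)).
Proof.
have nu'E : nu' (rhoT x) = dnext' (rhoT (dopp x)) by rewrite /nu' dopp'_rho.
case Sox: (S (dopp x)).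
  apply: eq_connect0; apply: val_inj => /=; rewrite /nu.
  case/orP: Sox => So.
    rewrite (rho2 (S1_next So)) -[x]doppK.
    by case: (S1_opp So) => [->|/rho2//]; rewrite rhoN.
  rewrite (rho1 (So : S1 _)) -[x]doppK.
  by case: (S2_opp So) => [->|/rho1//]; rewrite rhoN.
have <- : nu' (rhoT x) = rhoT (nu x).
  by rewrite nu'E; apply: val_inj; rewrite /= (rhoN (x := dopp x)) ?Sox.
exact: fconnect1.
Qed.

Let nu_val (x : dart') : fconnect nu (val x) (val (nu' x)).
Proof.
have Sx := valP x; rewrite dnext'E /=.
case S1x: (S1 (dopp (val x))).
  rewrite (rho1 S1x) (Sopp1 Sx S1x) fconnect_sym //.
  have := connect_rho (dopp e); rewrite (rho2 S2_e') => ed.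
  rewrite fconnect_sym //; rewrite fconnect_sym // in ed.
  apply: connect_trans ed _; rewrite -{2}[e]doppK; exact: fconnect1.
case S2x: (S2 (dopp (val x))).
  rewrite (rho2 S2x) (Sopp2 Sx S2x) fconnect_sym //.
  have := connect_rho d; rewrite (rho1 S1_d) => de.
  rewrite fconnect_sym //; rewrite fconnect_sym // in de.
  apply: connect_trans de _; exact: fconnect1.
by rewrite rhoN ?fconnect1 // /S /= S1x S2x.
Qed.

(** [val] and [rhoT] both respect vertices and are mutually inverse up to moves within a vertex, so
    they match the vertices of the two maps. *)
Let fcard_nu' : fcard nu' dart' = fcard nu (dart M).
Proof.
have cl : fclosed nu (dart M) by [].
rewrite (adjunction_n_comp (val : dart' -> dart M) (fconnect_sym nu_inj)
           (fconnect_sym nu'_inj) cl) //.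
split=> [x _|x y _]; first by exists (rhoT x); apply: connect_rho.
apply/idP/idP => xy.
  apply: (connect_ind (P := fun z => fconnect nu (val x) (val z)) _ xy) => //.
  move=> a b /eqP <- xa.
  exact: connect_trans xa (nu_val a).
rewrite -(rhoTK y); rewrite -{1}(rhoTK x).
apply: (connect_ind (P := fun z => fconnect nu' (rhoT (val x)) (rhoT z)) _ xy) => //.
move=> a b /eqP <- xa.
exact: connect_trans xa (nu'_rho a).
Qed.

(** The deleted faces are bigons, so as many faces as edges disappear, while the number of vertices
    is kept. *)
Let euler' : fcard nu' dart' + fcard dnext' dart' = fcard dopp' dart' + 2.
Proof.
have E' := fcard_involution dopp'K dopp'_neq.
have E := fcard_involution (@doppK _ M) (@dopp_neq _ M).
have clS : fclosed (@dnext _ M) S by move=> x y /eqP <-; apply/esym/S_next.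
have F' : fcard dnext' dart' = fcard (@dnext _ M) [predC S].
  exact: fcard_val dnext'E (@dnext_inj _ M) (predC_closed clS).
have FS : fcard (@dnext _ M) S * 2 = #|S|.
  apply: fcard_order_set => //; first exact: dnext_inj.
  apply/subsetP=> x; rewrite !inE; case/orP=> [/S1_bigon|/S2_bigon]/andP[_ o2] //.
have F := n_compC S (frel (@dnext _ M)).
have := deuler M; rewrite -/nu -fcard_nu'.
have cS : #|dart'| + #|S| = #|dart M|.
  by rewrite card_sig -(cardC S) addnC.
have arith v f fs n n' e0 e1 s : e1 * 2 = n' -> e0 * 2 = n -> fs * 2 = s ->
  n' + s = n -> v + (fs + f) = e0 + 2 -> v + f = e1 + 2 by lia.
rewrite F' F; exact: arith E' E FS cS.
Qed.

Definition remove_strip : disc_map A :=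
  @DiscMap A dart' dopp' dnext' (fun x => dlab (val x)) (rhoT (dbase M))
    dopp'K dopp'_neq dnext'_inj dlab'_opp dconnected' euler'.

Lemma ncells0_remove_strip : ncells 0 (Disc remove_strip) = ncells 0 (Disc M).
Proof. exact: fcard_nu'. Qed.

(** This decrease drives the induction that shortens all strips. *)
Lemma card_remove_strip : #|dart remove_strip| < #|dart M|.
Proof.
rewrite [X in X < _](_ : _ = #|[predC S]|); last by rewrite card_sig.
rewrite -(cardC S) -[X in X < _]add0n ltn_add2r.
by apply/card_gt0P; exists d; apply/orP; left; apply: S1_d.
Qed.

Let face_label' (x : dart') : face_label (x : dart remove_strip) = face_label (val x).
Proof. by rewrite /face_label -(map_val_orbit dnext'E) -map_comp. Qed.

Let S_inner x : S x -> inner x.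
Proof. by case/orP=> [/S1_bigon|/S2_bigon]/andP[]. Qed.

Let val_base : val (rhoT (dbase M)) = dbase M.
Proof.
rewrite /= rhoN //; apply/negP=> /S_inner; by rewrite /inner connect0.
Qed.

Lemma boundary_label_remove_strip :
  boundary_label (Disc remove_strip) = boundary_label (Disc M).
Proof. by rewrite /= face_label' val_base. Qed.

Lemma diagram_over_remove_strip R :
  diagram_over R (Disc M) -> diagram_over R (Disc remove_strip).
Proof.
move=> overM x; rewrite [fconnect _ _ _](fconnect_val dnext'E) val_base => /overM.
by rewrite face_label'.
Qed.

End RemoveStrip.

(** * Bounding edges by vertices through Euler's formula *)

Section EdgeBound.

Variables (A : finType) (M : disc_map A).

Lemma fcard_dopp : fcard (@dopp _ M) (dart M) * 2 = #|dart M|.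
Proof. exact: fcard_involution (@doppK _ M) (@dopp_neq _ M). Qed.

(** A bigon has one face and two darts, hence cancels in Euler's formula. What remains is the outer
    face [O] and the set [T] of darts on inner faces of degree at least 3. *)
Lemma card_nonbigon :
    (forall x : dart M, inner x -> 1 < order (@dnext _ M) x) ->
  #|[pred x : dart M | ~~ bigon x]| <= 6 * ncells 0 (Disc M).
Proof.
move=> inner_gt1; pose f := @dnext _ M; have injf : injective f := @dnext_inj _ M.
pose O : pred (dart M) := fconnect f (dbase M).
pose B : pred (dart M) := [pred x | bigon x].
pose T : pred (dart M) := [pred x | inner x && ~~ bigon x].
have splitF : fcard f (dart M) = 1 + fcard f B + fcard f T.
  rewrite (n_compC O) n_comp_connect; last exact: fconnect_sym.
  rewrite -addnA; congr (_ + _); rewrite /n_comp_mem -(cardID B).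
  congr (_ + _); apply: eq_card => x; rewrite !inE /= /bigon /inner.
    by rewrite /O /f; case: (fconnect _ _ x); case: (_ == 2); rewrite ?andbF ?andbT.
  by rewrite /O /f; case: (fconnect _ _ x); case: (_ == 2); rewrite ?andbF ?andbT.
have splitD : #|O| + #|B| + #|T| = #|dart M|.
  rewrite -(cardC O) -addnA; congr (_ + _); rewrite -(cardID B [predC O]).
  congr (_ + _); apply: eq_card => x; rewrite !inE /= /bigon /inner.
    by rewrite /O /f; case: (fconnect _ _ x); case: (_ == 2).
  by rewrite /O /f; case: (fconnect _ _ x); case: (_ == 2).
have O_gt0 : 0 < #|O| by apply/card_gt0P; exists (dbase M); apply: connect0.
have clB : fclosed f B by move=> x y /eqP <-; rewrite !inE bigon_dnext.
have clT : fclosed f T.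
  by move=> x y /eqP <-; rewrite !inE bigon_dnext inner_dnext.
have FB : fcard f B * 2 = #|B|.
  by apply: fcard_order_set => //; apply/subsetP=> x /andP[].
have FT : fcard f T * 3 <= #|T|.
  apply: leq_fcard_order => // x /andP[inx]; rewrite /bigon inx /= => o2.
  by rewrite ltn_neqAle eq_sym o2 inner_gt1.
have BC : #|B| + #|[pred x : dart M | ~~ bigon x]| = #|dart M| by rewrite -(cardC B).
(* Here [c = o + t]. The equalities give [2 v = o + t + 2 - 2 fT], which is at least
   [o + t / 3 + 2]. *)
have arith v e fB fT o b t c n : e * 2 = n -> v + (1 + fB + fT) = e + 2 ->
    fB * 2 = b -> fT * 3 <= t -> 0 < o -> o + b + t = n -> b + c = n ->
  c <= 6 * v by lia.
have := deuler M; rewrite -/f splitF => euler.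
exact: arith fcard_dopp euler FB FT O_gt0 splitD BC.
Qed.

(** Double counting of the pairs [(x, i)] such that [i] steps of [across] lead from [x] to a dart
    off the bigons: each [x] has such an [i], and by injectivity of [across] each [i] occurs once
    per dart off the bigons. *)
Lemma card_dart_nonbigon N :
    (forall x : dart M, exists2 i, i < N & ~~ bigon (iter i (@across _ M) x)) ->
  #|dart M| <= N * #|[pred x : dart M | ~~ bigon x]|.
Proof.
move=> short; rewrite -sum1_card -(card_ord N) -sum_nat_const.
apply: (@leq_trans (\sum_(x : dart M) \sum_(i : 'I_N)
                      ~~ bigon (iter i (@across _ M) x))).
  apply: leq_sum => x _; have [i lt_iN nb] := short x.
  by rewrite (bigD1 (Ordinal lt_iN)) //= nb.
rewrite exchange_big; apply: leq_sum => i _ /=.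
have inj_i : injective (iter i (@across _ M)).
  by elim: (i : nat) => // n IHn x y /across_inj /IHn.
rewrite -sum1_card [leqRHS]big_mkcond [leqRHS](reindex_inj inj_i) /=.
by apply: leq_sum => x _; rewrite inE; case: (bigon _).
Qed.

End EdgeBound.

(** Induction on the number of darts: while a long strip exists, a part of it between two equal
    labels is removed. *)
Lemma shorten_strips (A : finType) (R : word A -> Prop) (M : disc_map A) :
    diagram_over R (Disc M) ->
  exists M' : disc_map A,
    [/\ diagram_over R (Disc M'),
        boundary_label (Disc M') = boundary_label (Disc M),
        ncells 0 (Disc M') = ncells 0 (Disc M)
      & forall x : dart M', exists2 i, i < #|{: A * bool}| &
          ~~ bigon (iter i (@across _ M') x)].
Proof.
have [n] := ubnP #|dart M|; elim: n M => // n IHn M /ltnSE leMn overM.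
have [short | ] := boolP [forall x : dart M, exists i : 'I_#|{: A * bool}|,
                   ~~ bigon (iter i (@across _ M) x)].
  exists M; split=> // x; have /existsP[i nb] := forallP short x.
  by exists (i : nat).
rewrite negb_forall => /existsP[x]; rewrite negb_exists => /forallP strip_x.
have strip_x' i : i < #|{: A * bool}| -> bigon (iter i (@across _ M) x).
  by move=> lt_i; have := strip_x (Ordinal lt_i); rewrite negbK.
(* A strip of [n] bigons has [n + 1] parallel darts; with [n] letters, two of their labels
   coincide. *)
pose g (i : 'I_#|{: A * bool}|.+1) : A * bool := dlab (iter i (@across _ M) x).
have /injectivePn[i [j neq_ij eq_g]] : ~~ injectiveb g.
  apply/negP=> /injectiveP/leq_card; by rewrite card_ord ltnn.
wlog lt_ij : i j neq_ij eq_g / i < j.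
  move=> W; case: (ltngtP i j) => [lt_ij|lt_ji|/val_inj eq_ij].
  - exact: W neq_ij eq_g lt_ij.
  - by apply: (W j i) => //; rewrite eq_sym.
  - by rewrite eq_ij eqxx in neq_ij.
have k_gt0 : 0 < j - i by rewrite subn_gt0.
have strip_i : strip (j - i) (iter i (@across _ M) x).
  by move=> m lt_m; rewrite -iterD; apply: strip_x'; have := ltn_ord j; lia.
have lab_ij : dlab (iter (j - i) (@across _ M) (iter i (@across _ M) x))
            = dlab (iter i (@across _ M) x).
  by rewrite -iterD subnK 1?ltnW //; apply/esym/eq_g.
pose M1 := remove_strip k_gt0 strip_i lab_ij.
have [||M' [overM' bM' cM' shortM']] := IHn M1.
- exact: leq_trans (card_remove_strip _ _ _) leMn.
- exact: diagram_over_remove_strip.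
exists M'; split=> //; first by rewrite bM' boundary_label_remove_strip.
by rewrite cM' ncells0_remove_strip.
Qed.

Lemma size_winv (A : finType) (w : word A) : size (winv w) = size w.
Proof. by rewrite size_rev size_map. Qed.

Lemma exists_few_edges (A : finType) (R : word A -> Prop) (D : diagram A) :
    (forall r, R r -> 1 < size r) -> diagram_over R D ->
  exists D', [/\ diagram_over R D', boundary_label D' = boundary_label D
    & ncells 1 D' <= 3 * #|{: A * bool}| * ncells 0 D].
Proof.
move=> R_gt1; case: D => [|M] overD; first by exists (@Point A).
have [M' [overM' bM' cM' short]] := shorten_strips overD.
exists (Disc M'); split=> //; rewrite -cM'.
(* The degree of an inner face is the length of a relator. *)
have inner_gt1 (x : dart M') : inner x -> 1 < order (@dnext _ M') x.
  move=> /overM'[r [/R_gt1 r_gt1 xr]]; rewrite -size_orbit -(size_map (@dlab _ M')).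
  by case: xr => -[m] /(congr1 size); rewrite size_rot ?size_winv /face_label => ->.
(* The number of darts is twice the number of edges, which turns the factor 6 into 3. *)
have := leq_trans (card_dart_nonbigon short) (leq_mul (leqnn _) (card_nonbigon inner_gt1)).
rewrite -fcard_dopp [ncells 1 _]/=; move: (ncells 0 _) #|_| (fcard _ _) => v m e; lia.
Qed.

(** * Minimal fillings and Dehn functions *)

Lemma min_natP (P : nat -> Prop) : (exists n, P n) -> P (min_nat P).
Proof.
case=> n Pn; rewrite /min_nat; case: pselect => [exP|[]]; last first.
  by exists n; apply/asboolP.
by case: ex_minnP => m /asboolP.
Qed.

Lemma min_nat_leq (P : nat -> Prop) n : P n -> min_nat P <= n.
Proof.
move=> Pn; rewrite /min_nat; case: pselect => // exP.
by case: ex_minnP => m _; apply; apply/asboolP.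
Qed.

Lemma min_nat0 (P : nat -> Prop) : (forall n, ~ P n) -> min_nat P = 0.
Proof.
move=> noP; rewrite /min_nat; case: pselect => // exP.
by exfalso; case: exP => n /asboolP/noP.
Qed.

Section Fillings.

Variables (A : finType) (R : word A -> Prop).

Lemma leq_filling i j c W :
    (forall D, diagram_over R D -> cyclic_eq (boundary_label D) W ->
      exists D', [/\ diagram_over R D', cyclic_eq (boundary_label D') W
        & ncells i D' <= c * ncells j D]) ->
  filling R i W <= c * filling R j W.
Proof.
move=> fill; have [[D [overD DW]] | noD] :=
  pselect (exists D, diagram_over R D /\ cyclic_eq (boundary_label D) W).
  have exD : exists n, exists D : diagram A,
      [/\ diagram_over R D, cyclic_eq (boundary_label D) W & ncells j D = n].
    by exists (ncells j D), D.
  have [D0 [overD0 D0W minD0]] := min_natP exD; rewrite [filling R j W]/filling -minD0.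
  have [D' [overD' D'W le_c]] := fill D0 overD0 D0W.
  by apply: leq_trans le_c; apply: min_nat_leq; exists D'.
(* If [W] bounds no diagram, the left side has the default value 0. *)
rewrite {1}/filling min_nat0 // => n [D [overD DW _]].
by apply: noD; exists D.
Qed.

Lemma leq_dehn i j c x :
    (forall W, W != [::] -> filling R i W <= c * filling R j W) ->
  dehn R i x <= c * dehn R j x.
Proof.
move=> fill; apply/bigmax_leqP_seq => n; rewrite mem_index_iota => n_x _.
apply/bigmax_leqP => W nW; apply: leq_trans (fill W _) _.
  by rewrite -size_eq0 size_tuple; case/andP: n_x => /lt0n_neq0.
rewrite leq_mul2l; apply/orP; right.
apply: leq_trans (leq_bigmax_seq (F := fun n =>
  \max_(W : n.-tuple (letter A) | `[< normal_closure R W >]) filling R j W) n _ _) => //.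
  exact: (leq_bigmax_cond (F := fun W : n.-tuple (letter A) => filling R j W)).
by rewrite mem_index_iota.
Qed.

Lemma dehn_mono j x y : x <= y -> dehn R j x <= dehn R j y.
Proof.
move=> le_xy; apply/bigmax_leqP_seq => n; rewrite mem_index_iota => n_x _.
apply: (leq_bigmax_seq (F := fun n =>
  \max_(W : n.-tuple (letter A) | `[< normal_closure R W >]) filling R j W)) => //.
by rewrite mem_index_iota; lia.
Qed.

Lemma dominated_dehn i j c :
    (forall x, 0 < x -> dehn R i x <= c * dehn R j x) ->
  dominated (dehn R i) (dehn R j).
Proof.
(* The successor keeps the constant positive when [c] is 0. *)
move=> le_c; exists c.+1; split=> // x x_gt0.
apply: leq_trans (le_c x x_gt0) _; apply: leq_trans (leq_addr _ _).
by apply: leq_mul => //; apply: dehn_mono; rewrite leq_pmull.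
Qed.

End Fillings.

Theorem theorem1p4 (A : finType) (R : word A -> Prop)
    (R_cyc : forall r, R r -> r <> [::] /\ cyclically_reduced r) :
  ((forall x, 0 < x ->
      dehn R 0 x <= 2 * dehn R 1 x /\ dehn R 2 x <= 2 * dehn R 1 x) /\
   dominated (dehn R 0) (dehn R 1) /\ dominated (dehn R 2) (dehn R 1)) /\
  ((forall r, R r -> 1 < size r) -> lin_equiv (dehn R 0) (dehn R 1)).
Proof.
have le2 j x : j != 1 -> dehn R j x <= 2 * dehn R 1 x.
  move=> j_neq1; apply: leq_dehn => W W_neq0; apply: leq_filling => D overD DW.
  exists D; split=> //; case: D DW {overD} => [[m W0] | M _].
    (* The one-vertex diagram, with a vertex but no edge, bounds only the empty word. *)
    by have := congr1 size W0; rewrite size_rot => /esym/size0nil/eqP; rewrite (negPf W_neq0).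
  (* There are [2 E] darts, and the vertices and faces are orbits of darts; for [j] above 2 the
     count is 0. *)
  have := fcard_dopp M; case: j j_neq1 => [|[|[|j]]] // _ E.
    by rewrite /= mulnC E leq_fcard.
  by rewrite /= mulnC E (leq_trans (leq_pred _)) ?leq_fcard.
have dom j : j != 1 -> dominated (dehn R j) (dehn R 1).
  by move=> j_neq1; apply: dominated_dehn => x _; apply: le2.
split; first by split; [move=> x _; split; apply: le2 | split; apply: dom].
move=> R_gt1; split; first exact: dom.
apply: (dominated_dehn (c := 3 * #|{: A * bool}|)) => x _.
apply: leq_dehn => W _; apply: leq_filling => D overD DW.
have [D' [overD' bD' le_D']] := exists_few_edges R_gt1 overD.
by exists D'; split; rewrite ?bD'.
Qed.
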